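(* Balanced Cluster Completion admits an algorithm that, on an instance $(G,k,\eta)$ where $G$ has $n$ vertices, correctly decides the instance in time $2^{\mathcal{O}(k)}n^{\mathcal{O}(1)}$.
   Context: All graphs are finite and simple. A cluster graph is a graph in which every connected component is a clique. For a non-negative integer $\eta$, a graph is $\eta$-balanced if for any two connected components $H,H'$ we have $\big||V(H)|-|V(H')|\big|\le\eta$. Balanced Cluster Completion: given a cluster graph $G$ and non-negative integers $k,\eta$, decide whether there is a set $F$ of non-edges of $G$ with $|F|\le k$ such that the graph obtained from $G$ by adding $F$ is an $\eta$-balanced cluster graph. *)

(* Defs.v *)
From mathcomp Require Import all_boot all_order all_algebra.

Set Implicit Arguments.
Unset Strict Implicit.
Unset Printing Implicit Defensive.

(** * Graphs *)

Record sgraph (T : finType) := SGraph {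
  adj :> rel T;
  adj_sym : symmetric adj;
  adj_irr : irreflexive adj }.

Section Graphs.
Variable T : finType.
Implicit Types (G : sgraph T) (A : {set T}) (F : {set {set T}}).

Definition components G : {set {set T}} := [set [set y | connect G x y] | x : T].

Definition clique G A : bool :=
  [forall x in A, forall y in A, (x != y) ==> G x y].

Definition cluster_graph G : bool := [forall A in components G, clique G A].

(* The distance is that of [int]: it is not truncated. *)
Definition balanced (eta : nat) G : bool :=
  [forall A in components G, forall B in components G,
     absz (Posz #|A| - Posz #|B|)%R <= eta].

(* An unordered pair of distinct vertices is a set of two vertices. *)
Definition non_edges G : {set {set T}} :=
  [set [set p.1; p.2] | p : T * T & (p.1 != p.2) && ~~ G p.1 p.2].

(* The test [x != y] only matters when [F] contains singletons, hence never
   for [F \subset non_edges G]; it makes the result a simple graph for all [F]. *)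
Definition add_rel G F : rel T :=
  fun x y => G x y || ((x != y) && ([set x; y] \in F)).

Lemma add_rel_sym G F : symmetric (add_rel G F).
Proof. by move=> x y; rewrite /add_rel adj_sym eq_sym setUC. Qed.

Lemma add_rel_irr G F : irreflexive (add_rel G F).
Proof. by move=> x; rewrite /add_rel adj_irr eqxx. Qed.

Definition add_edges G F : sgraph T :=
  SGraph (add_rel_sym G F) (add_rel_irr G F).

Definition balanced_cluster_completion G (k eta : nat) : bool :=
  [exists F : {set {set T}},
     [&& F \subset non_edges G, #|F| <= k,
         cluster_graph (add_edges G F) & balanced eta (add_edges G F)]].

End Graphs.

(** * Random access machines

  The machine of Cook and Reckhow (Time bounded random access machines, 1973)
  with unit cost, over the natural numbers: registers X_0, X_1, ..., and a
  read-only input read from left to right. There is no multiplication, so t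
  steps lengthen the numbers at hand by at most t bits, and unit cost is
  polynomially related to Turing machine time. *)

Inductive instr : Type :=
| Const (i c : nat)        (* X_i := c *)
| Add (i j l : nat)        (* X_i := X_j + X_l *)
| Sub (i j l : nat)        (* X_i := X_j - X_l, truncated at 0 *)
| Fetch (i j : nat)        (* X_i := X_{X_j} *)
| Store (i j : nat)        (* X_{X_i} := X_j *)
| Jpos (p j : nat)         (* go to instruction p if X_j > 0 *)
| Read (i : nat).          (* X_i := next input number, 0 if there is none *)

Definition program := seq instr.

Record config := Config {
  pc : nat;
  reg : nat -> nat;
  inp : seq nat }.

Definition upd (X : nat -> nat) (i v : nat) : nat -> nat :=
  fun j => if j == i then v else X j.

Definition exec (a : instr) (s : config) : config :=
  let: Config p X w := s in
  match a with
  | Const i c => Config p.+1 (upd X i c) w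
  | Add i j l => Config p.+1 (upd X i (X j + X l)) w
  | Sub i j l => Config p.+1 (upd X i (X j - X l)) w
  | Fetch i j => Config p.+1 (upd X i (X (X j))) w
  | Store i j => Config p.+1 (upd X (X i) (X j)) w
  | Jpos q j => Config (if 0 < X j then q else p.+1) X w
  | Read i => Config p.+1 (upd X i (head 0 w)) (behead w)
  end.

(* The machine halts when the program counter leaves the program; a halted
   configuration is a fixed point of [step]. *)
Definition halted (P : program) (s : config) : bool := size P <= pc s.

Definition step (P : program) (s : config) : config :=
  if halted P s then s else exec (nth (Const 0 0) P (pc s)) s.

Definition init (w : seq nat) : config := Config 0 (fun=> 0) w.

Definition run (P : program) (w : seq nat) (t : nat) : config :=
  iter t (step P) (init w).

(* On input [w], [P] halts after at most [t] steps with answer [b] in X_0. *)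
Definition answers_within (P : program) (w : seq nat) (t : nat) (b : bool) : Prop :=
  halted P (run P w t) /\ reg (run P w t) 0 = b.

(* n, k, eta, then the adjacency matrix of the graph, row by row. *)
Definition encode (n : nat) (G : sgraph 'I_n) (k eta : nat) : seq nat :=
  [:: n; k; eta] ++ [seq nat_of_bool (G i j) | i <- enum 'I_n, j <- enum 'I_n].

(* Main.v *)
Require Import Defs.
From mathcomp Require Import all_boot all_order all_algebra.
From mathcomp Require Import zify.

(* A completion of a cluster graph is obtained by successively merging two
   components, and merging components of sizes a and b costs a b edges. Only
   the sizes matter, so a completion with at most k edges is described by a
   sequence of pairs (a, b) with sum of the a b at most k; as a + b + 1 <= 3 a b,
   written in unary it is a word of length at most 3 k over three letters.
   The machine tries all words of length 3 k + 1, read as the ternary numbers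
   below 3 ^ (3 k + 1) = 2 ^ O(k), simulating each of them on the table of
   component sizes. *)

Set Implicit Arguments.
Unset Strict Implicit.
Unset Printing Implicit Defensive.

(** * A structured language and its compilation *)

(** Merging suffices because one added edge between two components forces all pairs between them,
    and adding exactly these pairs leaves a cluster graph to which the rest of the completion
    applies. Cost and balance depend on the sizes alone, so no vertex is ever guessed; this keeps
    [n] out of the exponential factor. The machine only adds and subtracts with truncation, and this
    shapes the certificates. With sizes spelled in unary, each letter raises the product of the two
    sizes by the other size. Digits are split off by tripling a number and comparing it with a fixed
    power of 3. A merge with too few vertices is carried out all the same, while the shortage lost
    by truncation is recorded and spoils the word for good. Shorter words are padded with the letter
    0, which costs nothing while the second size is 0. The length [3 * k + 1] is positive even for
    [k = 0], as required by loops that are tested at their end and thus always run once. *)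

Record memory := Mem { var : nat -> nat; arr : bool -> nat -> nat; tape : seq nat }.

Inductive prim :=
| PConst of nat & nat
| PAdd of nat & nat & nat
| PSub of nat & nat & nat
| PLoad of nat & bool & nat
| PStore of bool & nat & nat
| PRead of nat.

Definition upd_arr (A : bool -> nat -> nat) (t : bool) i v : bool -> nat -> nat :=
  fun t' => if t' == t then upd (A t) i v else A t'.

Definition exec_prim (s : memory) (p : prim) : memory :=
  let: Mem V A w := s in
  match p with
  | PConst i c => Mem (upd V i c) A w
  | PAdd i j l => Mem (upd V i (V j + V l)) A w
  | PSub i j l => Mem (upd V i (V j - V l)) A w
  | PLoad i t j => Mem (upd V i (A t (V j))) A w
  | PStore t i j => Mem V (upd_arr A t (V i) (V j)) w
  | PRead i => Mem (upd V i (head 0 w)) A (behead w)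
  end.

(** Both control constructs cost a single [Jpos]: [Unless] jumps over its body when the variable is
    positive, and [Do] jumps back after its body while the variable is positive. *)
Inductive cmd :=
| Block of seq prim
| Seq of cmd & cmd
| Unless of nat & cmd
| Do of cmd & nat.

(* Variable i < 24 lives in X_i, X_24 is scratch, and entry i of the array t
   lives in X_(25 + t + 2 i), so that both arrays are unbounded. *)
Definition prim_code (p : prim) : seq instr :=
  match p with
  | PConst i c => [:: Const i c]
  | PAdd i j l => [:: Add i j l]
  | PSub i j l => [:: Defs.Sub i j l]
  | PLoad i t j =>
      [:: Const 24 (25 + t); Add 24 24 j; Add 24 24 j; Fetch i 24]
  | PStore t i j =>
      [:: Const 24 (25 + t); Add 24 24 i; Add 24 24 i; Store 24 j]
  | PRead i => [:: Read i]
  end.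

Fixpoint code (off : nat) (c : cmd) : seq instr :=
  match c with
  | Block ps => flatten (map prim_code ps)
  | Seq c1 c2 => let l := code off c1 in l ++ code (off + size l) c2
  | Unless j c1 => let l := code off.+1 c1 in Jpos (off.+1 + size l) j :: l
  | Do c1 j => rcons (code off c1) (Jpos off j)
  end.

Definition wf_prim (p : prim) : bool :=
  match p with
  | PConst i _ | PRead i => i < 24
  | PAdd i j l | PSub i j l => [&& i < 24, j < 24 & l < 24]
  | PLoad i _ j | PStore _ i j => (i < 24) && (j < 24)
  end.

Fixpoint wf (c : cmd) : bool :=
  match c with
  | Block ps => all wf_prim ps
  | Seq c1 c2 => wf c1 && wf c2
  | Unless j c1 | Do c1 j => (j < 24) && wf c1
  end.

Inductive ev : cmd -> memory -> nat -> memory -> Prop :=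
| ev_block ps s :
    ev (Block ps) s (size (flatten (map prim_code ps))) (foldl exec_prim s ps)
| ev_seq c1 c2 s t1 s1 t2 s2 :
    ev c1 s t1 s1 -> ev c2 s1 t2 s2 -> ev (Seq c1 c2) s (t1 + t2) s2
| ev_unless_skip j c s : 0 < var s j -> ev (Unless j c) s 1 s
| ev_unless_run j c s t s' :
    var s j = 0 -> ev c s t s' -> ev (Unless j c) s t.+1 s'
| ev_do_stop c j s t s' : ev c s t s' -> var s' j = 0 -> ev (Do c j) s t.+1 s'
| ev_do_loop c j s t s' t' s'' :
    ev c s t s' -> 0 < var s' j -> ev (Do c j) s' t' s'' ->
    ev (Do c j) s (t.+1 + t') s''.

(** * Simulation of the structured language by the machine *)

Definition sim (s : memory) (X : nat -> nat) : Prop :=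
  (forall i, i < 24 -> X i = var s i) /\
  (forall (t : bool) i, X (25 + t + i + i) = arr s t i).

Lemma step_at (P pre post : program) a X w :
  P = pre ++ a :: post ->
  step P (Config (size pre) X w) = exec a (Config (size pre) X w).
Proof.
move=> ->; rewrite /step /halted /= size_cat /= addnS leqNgt ltnS leq_addr /=.
by rewrite nth_cat ltnn subnn.
Qed.

Definition is_jump a := if a is Jpos _ _ then true else false.

Lemma iter_step_straight (P pre l post : program) X w :
  P = pre ++ l ++ post -> all (predC is_jump) l ->
  iter (size l) (step P) (Config (size pre) X w) =
  foldl (fun s a => exec a s) (Config (size pre) X w) l.
Proof.
elim: l pre X w => // a l IH pre X w eP /andP[na nl].
have [X' [w' e]] : exists X' w', exec a (Config (size pre) X w) =
    Config (size (rcons pre a)) X' w'.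
  by rewrite size_rcons; case: a na {eP} => //= *; do 2!eexists.
rewrite iterSr (step_at _ _ eP) e IH ?cat_rcons //.
by rewrite -e.
Qed.

Lemma upd_sim V A w X i v : i < 24 -> sim (Mem V A w) X ->
  sim (Mem (upd V i v) A w) (upd X i v).
Proof.
move=> lti [hV hA]; split=> [j ltj|t j] /=; rewrite /upd; first by case: eqP; auto.
by case: eqP => [|_]; [lia | exact: hA].
Qed.

Lemma scratch_sim s X v : sim s X -> sim s (upd X 24 v).
Proof.
case=> hV hA; split=> [j ltj|t j] /=; rewrite /upd.
  by case: eqP => [|_]; [lia | exact: hV].
by case: eqP => [|_]; [lia | exact: hA].
Qed.

(** The parity of the address [25 + t + i + i] determines [t], and then its value determines [i]; no
    other entry is hit. *)
Lemma sim_upd_arr V A w X t i v : sim (Mem V A w) X ->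
  sim (Mem V (upd_arr A t i v) w) (upd X (25 + t + i + i) v).
Proof.
case=> hV hA; split=> [j ltj|t' j] /=.
  by rewrite /upd; case: eqP => [|_]; [lia | exact: hV].
rewrite /upd_arr; case: (t' =P t) => [->|tt'].
  rewrite /upd; case: eqP => [e|ne]; first by rewrite (_ : j = i) ?eqxx //; lia.
  by case: eqP => [e|_]; [case: ne; rewrite e | exact: hA].
rewrite /upd; case: eqP => [e|_]; last exact: hA.
by case: t t' tt' e => [] [] //= _; lia.
Qed.

Lemma prim_code_correct (P pre post : program) p s X :
  P = pre ++ prim_code p ++ post -> wf_prim p -> sim s X ->
  exists2 X', iter (size (prim_code p)) (step P) (Config (size pre) X (tape s)) =
      Config (size pre + size (prim_code p)) X' (tape (exec_prim s p))
    & sim (exec_prim s p) X'.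
Proof.
move=> eP wfp sX; rewrite (iter_step_straight _ _ eP); last by case: p {eP wfp}.
case: s sX => V A w sX; have [hV hA] := sX.
case: p wfp {eP} => [i c|i j l|i j l|i t j|t i j|i] /=.
- by move=> h; exists (upd X i c); rewrite ?addn1 //; apply: upd_sim.
- case/and3P=> hi hj hl; rewrite !hV //= addn1.
  by eexists; [reflexivity | apply: upd_sim].
- case/and3P=> hi hj hl; rewrite !hV //= addn1.
  by eexists; [reflexivity | apply: upd_sim].
- case/andP=> hi hj; rewrite addn4; eexists; first reflexivity.
  set X3 := upd (upd (upd X _ _) _ _) _ _.
  have s3 : sim (Mem V A w) X3 by do 3!apply: scratch_sim.
  have -> : X3 24 = 25 + t + V j + V j by rewrite /X3 /upd /= (ltn_eqF hj) hV.
  by rewrite (s3.2 t (V j)); apply: upd_sim.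
- case/andP=> hi hj; rewrite addn4; eexists; first reflexivity.
  set X3 := upd (upd (upd X _ _) _ _) _ _.
  have s3 : sim (Mem V A w) X3 by do 3!apply: scratch_sim.
  have -> : X3 24 = 25 + t + V i + V i by rewrite /X3 /upd /= (ltn_eqF hi) hV.
  by rewrite (s3.1 j hj); apply: sim_upd_arr.
- by move=> h; rewrite addn1; eexists; [reflexivity | apply: upd_sim].
Qed.

Lemma block_correct (P pre post : program) ps s X :
  P = pre ++ flatten (map prim_code ps) ++ post -> all wf_prim ps -> sim s X ->
  let l := flatten (map prim_code ps) in
  exists2 X', iter (size l) (step P) (Config (size pre) X (tape s)) =
      Config (size pre + size l) X' (tape (foldl exec_prim s ps))
    & sim (foldl exec_prim s ps) X'.
Proof.
elim: ps pre s X => [|p ps IH] pre s X /= eP.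
  by move=> _ sX; exists X => //; rewrite addn0.
case/andP=> wp wps sX; rewrite -catA in eP.
have [X1 e1 s1] := prim_code_correct eP wp sX.
rewrite catA in eP; have [X2 e2 s2] := IH _ _ _ eP wps s1.
exists X2 => //; rewrite size_cat (addnC (size (prim_code p))) iterD e1.
by move: e2; rewrite size_cat => ->; congr Config; lia.
Qed.

(** Jump targets are absolute, so code is compiled for the length of the prefix in front of it and
    the claim is made for every prefix. Induction on the evaluation, not on the command, covers the
    repeated passes of a loop. *)
Lemma code_correct c s t s' (P pre post : program) X :
  ev c s t s' -> P = pre ++ code (size pre) c ++ post -> wf c -> sim s X ->
  exists2 X', iter t (step P) (Config (size pre) X (tape s)) =
      Config (size pre + size (code (size pre) c)) X' (tape s')
    & sim s' X'.
Proof.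
move=> e; elim: e P pre post X => {c s t s'}.
- by move=> ps s P pre post X /= eP wfp sX; apply: (block_correct eP wfp sX).
- move=> c1 c2 s t1 s1 t2 s2 _ IH1 _ IH2 P pre post X /= eP /andP[w1 w2] sX.
  rewrite -catA in eP; have [X1 e1 sX1] := IH1 _ _ _ _ eP w1 sX.
  rewrite catA -size_cat in eP; have [X2 e2 sX2] := IH2 _ _ _ _ eP w2 sX1.
  exists X2 => //; rewrite addnC iterD e1.
  by move: e2; rewrite !size_cat => ->; congr Config; lia.
- move=> j c s pos P pre post X /= eP /andP[ltj wc] sX.
  exists X => //; rewrite (step_at _ _ eP) /= sX.1 // pos.
  by rewrite addSn addnS.
- move=> j c s t s' z _ IH P pre post X /= eP /andP[ltj wc] sX.
  move: eP; set a := Jpos _ _ => eP.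
  have eP' : P = rcons pre a ++ code (size (rcons pre a)) c ++ post.
    by rewrite size_rcons cat_rcons.
  have [X1 e1 sX1] := IH _ _ _ _ eP' wc sX.
  exists X1 => //; rewrite -iterS iterSr (step_at _ _ eP) /= sX.1 // z /=.
  by move: e1; rewrite !size_rcons addSn addnS.
- move=> c j s t s' _ IH z P pre post X /= eP /andP[ltj wc] sX.
  rewrite cat_rcons in eP; have [X1 e1 sX1] := IH _ _ _ _ eP wc sX.
  exists X1 => //; rewrite /= e1 -size_cat; rewrite catA in eP.
  by rewrite (step_at _ _ eP) /= sX1.1 // z /= size_rcons size_cat addnS.
- move=> c j s t s' t' s'' _ IH pos _ IH' P pre post X /= eP /andP[ltj wc] sX.
  have eP0 := eP; rewrite cat_rcons in eP; have [X1 e1 sX1] := IH _ _ _ _ eP wc sX.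
  have [] := IH' P pre post X1 => //=; first by rewrite ltj.
  move=> X2 e2 sX2; exists X2 => //;
    rewrite -[LHS]/(iter (t.+1 + t') (step P) _) (addnC t.+1) iterD /= e1
    -(size_cat pre (code _ c)).
  rewrite catA in eP.
     by rewrite (step_at _ _ eP) /= sX1.1 // pos.
Qed.

Lemma answers_within_leq P w t t' b :
  t <= t' -> answers_within P w t b -> answers_within P w t' b.
Proof.
move=> le; rewrite /answers_within /run -(subnK le) iterD.
elim: (t' - t) => //= d IH h; have [h1 h2] := IH h.
by rewrite /step h1.
Qed.

(* [t] bounds the number of machine steps, not of commands. *)
Definition runs c s t (Q : memory -> Prop) : Prop :=
  exists t' s', [/\ ev c s t' s', t' <= t & Q s'].

Definition zero_mem w := Mem (fun=> 0) (fun _ _ => 0) w.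

Lemma runs_answers c w t (b : bool) :
  wf c -> runs c (zero_mem w) t (fun s => var s 0 = b :> nat) ->
  answers_within (code 0 c) w t b.
Proof.
move=> wc [t' [s' [e le q]]]; apply: (answers_within_leq le).
have e0 : code 0 c = [::] ++ code (size ([::] : program)) c ++ [::] by rewrite cats0.
have [X' e1 [hV _]] := code_correct (X :=
  fun=> 0) e e0 wc (conj (fun _ _ => erefl) (fun _ _ => erefl)).
by rewrite /answers_within /run /init e1 /halted /= add0n leqnn hV.
Qed.

(** * Program logic with time bounds *)

Lemma runs_weaken c s t t' (Q Q' : memory -> Prop) :
  t <= t' -> (forall s', Q s' -> Q' s') -> runs c s t Q -> runs c s t' Q'.
Proof.
move=> le h [u [s' [e le' q]]]; exists u, s'; split=> //; last exact: h.
exact: leq_trans le' le.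
Qed.

Lemma runs_block ps s (Q : memory -> Prop) :
  Q (foldl exec_prim s ps) -> runs (Block ps) s (size ps * 4) Q.
Proof.
move=> q; eexists; eexists; split; [exact: ev_block | | exact: q].
by elim: ps {q} => //= p ps IH; rewrite size_cat mulSn leq_add //; case: p.
Qed.

Lemma runs_seq c1 c2 s t1 t2 (Q : memory -> Prop) :
  runs c1 s t1 (fun s' => runs c2 s' t2 Q) -> runs (Seq c1 c2) s (t1 + t2) Q.
Proof.
case=> u1 [s1 [e1 l1 [u2 [s2 [e2 l2 q]]]]]; exists (u1 + u2), s2; split=> //.
- exact: ev_seq e1 e2.
- exact: leq_add.
Qed.

Lemma runs_unless j c s t (Q : memory -> Prop) :
  (0 < var s j -> Q s) -> (var s j = 0 -> runs c s t Q) ->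
  runs (Unless j c) s t.+1 Q.
Proof.
case: (posnP (var s j)) => [z _ /(_ z) [u [s' [e l q]]]|pos /(_ isT) q _].
  by exists u.+1, s'; split=> //; apply: ev_unless_run.
by exists 1, s; split=> //; apply: ev_unless_skip.
Qed.

(** The invariant is indexed by the passes still to be made. The counter has to agree with the index
    only after the body, where it is tested. *)
Lemma runs_do c j t m s (Inv : nat -> memory -> Prop) :
  Inv m.+1 s ->
  (forall i s, Inv i.+1 s -> runs c s t (fun s' => Inv i s' /\ var s' j = i)) ->
  runs (Do c j) s (m.+1 * t.+1) (Inv 0).
Proof.
move=> i0 h; elim: m s i0 => [|m IH] s /h [u [s' [e l [q v]]]].
  by exists u.+1, s'; split=> //; [apply: ev_do_stop | rewrite mul1n].
have [u' [s'' [e' l' q']]] := IH _ q.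
exists (u.+1 + u'), s''; split=> //; first by apply: ev_do_loop e _ e'; rewrite v.
by rewrite mulSn; apply: leq_add.
Qed.

(** * Merging two components of a cluster graph *)

Definition debit (N : nat -> nat) (a : nat) : nat -> nat := upd N a (N a - a).

Definition merge_count (N : nat -> nat) (a b : nat) : nat -> nat :=
  let N' := debit (debit N a) b in upd N' (a + b) (N' (a + b) + (a + b)).

(** The total lost by truncation in the two successive debits. Taking the second one after the first
    makes a merge of equal sizes require two distinct components. *)
Definition deficit (N : nat -> nat) (a b : nat) : nat :=
  (a - N a) + (b - debit N a b).

Lemma merge_count_ext N N' a b :
  N =1 N' -> merge_count N a b =1 merge_count N' a b.
Proof. by move=> e s; rewrite /merge_count /debit /upd !e. Qed.

Lemma deficit_ext N N' a b : N =1 N' -> deficit N a b = deficit N' a b.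
Proof. by move=> e; rewrite /deficit /debit /upd !e. Qed.

Section Cluster.
Variable T : finType.
Implicit Types (G H : sgraph T) (A B : {set T}) (F : {set {set T}}).

Definition comp_of G x : {set T} := [set y | connect G x y].

(* Counting vertices instead of components avoids any division: the entry for
   [s] is [s] times the number of components of size [s]. *)
Definition vcount G s : nat := #|[set v | #|comp_of G v| == s]|.

Lemma connectC G : symmetric (connect G).
Proof. by apply: sym_connect_sym; apply: adj_sym. Qed.

Lemma connect_min (e : rel T) (E : rel T) :
  reflexive E -> transitive E -> subrel e E -> subrel (connect e) E.
Proof.
move=> rE tE sE x y /connectP[p]; elim: p x => [|z p IH] x /=.
  by move=> _ ->; apply: rE.
by case/andP=> /sE xz zp ey; apply: tE xz (IH _ zp ey).
Qed.

Lemma clusterP G :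
  reflect (forall x y, connect G x y -> x != y -> G x y) (cluster_graph G).
Proof.
apply: (iffP forall_inP) => [h x y xy|h _ /imsetP[x _ ->]].
  have hx : comp_of G x \in components G by apply/imsetP; exists x.
  have /forall_inP/(_ x) := h _ hx.
  by rewrite inE connect0 => /(_ isT)/forall_inP/(_ y);
    rewrite inE xy => /(_ isT)/implyP.
apply/forall_inP=> u; rewrite inE => xu; apply/forall_inP=> v; rewrite inE => xv.
by apply/implyP; apply: h; apply: connect_trans xv; rewrite connectC.
Qed.

Lemma eq_cluster_graph G H : G =2 H -> cluster_graph G -> cluster_graph H.
Proof.
by move=> e /clusterP h; apply/clusterP=> x y; rewrite -(eq_connect e) -e; apply: h.
Qed.

Lemma eq_vcount G H : G =2 H -> vcount G =1 vcount H.
Proof.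
move=> e s; apply: eq_card => v; rewrite !inE; congr (_ == _).
by apply: eq_card => w; rewrite !inE (eq_connect e).
Qed.

Lemma comp_of_eq G x y : connect G x y -> comp_of G x = comp_of G y.
Proof. by move=> h; apply/setP=> z; rewrite !inE (same_connect (connectC G) h). Qed.

Lemma comp_of_gt0 G x : 0 < #|comp_of G x|.
Proof. by apply/card_gt0P; exists x; rewrite inE. Qed.

Lemma set2_inj (u v x y : T) : [set u; v] = [set x; y] ->
  (u = x /\ v = y) \/ (u = y /\ v = x).
Proof.
move=> /setP e; have := e u; have := e v; have := e x; have := e y.
rewrite !inE !eqxx ?orbT /=.
move=> /orP[]/eqP ? /orP[]/eqP ? /esym/orP[]/eqP ? /esym/orP[]/eqP ?; subst; auto.
Qed.

Lemma mem_non_edges G x y : ([set x; y] \in non_edges G) = (x != y) && ~~ G x y.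
Proof.
apply/imsetP/idP => [[[u v]]|h]; last by exists (x, y); rewrite // inE.
by rewrite inE /= => huv /set2_inj[][-> ->] //; rewrite eq_sym adj_sym.
Qed.

Lemma non_edgesP G e :
  reflect (exists x y, [/\ e = [set x; y], x != y & ~~ G x y]) (e \in non_edges G).
Proof.
apply: (iffP imsetP) => [[[x y]]|[x [y [-> xy nxy]]]].
  by rewrite inE => /andP[xy nxy] ->; exists x, y.
by exists (x, y); rewrite // inE xy.
Qed.

Definition cross A B : {set {set T}} := [set [set p.1; p.2] | p in setX A B].

Lemma mem_cross A B x y : ([set x; y] \in cross A B) =
  (x \in A) && (y \in B) || (y \in A) && (x \in B).
Proof.
apply/imsetP/idP => [[[u v]]|].
  rewrite inE /= => /andP[uA vB] /set2_inj[][-> ->]; rewrite uA vB ?orbT //.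
case/orP=> /andP[h1 h2]; first by exists (x, y); rewrite // inE h1.
by exists (y, x); rewrite /= ?inE ?h1 // setUC.
Qed.

Lemma card_cross A B : [disjoint A & B] -> #|cross A B| = #|A| * #|B|.
Proof.
move=> dAB; rewrite -cardsX; apply: card_in_imset => [[u v] [x y]].
rewrite !inE /= => /andP[uA vB] /andP[xA yB] /set2_inj[][eu ev]; first by rewrite eu ev.
by move: (disjointFr dAB xA); rewrite -ev vB.
Qed.

Lemma cross_sub_non_edges G x y : ~~ connect G x y ->
  cross (comp_of G x) (comp_of G y) \subset non_edges G.
Proof.
move=> nxy; apply/subsetP=> _ /imsetP[[u v] /setXP[/= uA vB] ->].
rewrite !inE in uA vB; rewrite mem_non_edges.
have nuv : ~~ connect G u v.
  apply: contra nxy => uv; apply: connect_trans uA (connect_trans uv _).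
  by rewrite connectC.
apply/andP; split; first by apply: contra nuv => /eqP->; apply: connect0.
by apply: contra nuv; apply: connect1.
Qed.

Lemma disjoint_comp_of G x y : ~~ connect G x y ->
  [disjoint comp_of G x & comp_of G y].
Proof.
move=> nxy; apply/pred0P=> z /=; rewrite !inE; apply/negP=> /andP[xz yz].
by case/negP: nxy; apply: connect_trans xz _; rewrite connectC.
Qed.

Lemma vcount_sum G s : vcount G s = \sum_v (#|comp_of G v| == s).
Proof. by rewrite /vcount -sum1_card big_mkcond /=; apply: eq_bigr => v _;
  rewrite inE; case: eqP. Qed.

(** The vertices of the component of [x] are all counted at the same entry, and their number is the
    size itself, so the debit removes precisely them. *)
Lemma debit_vcount G x s : debit (vcount G) #|comp_of G x| s =
  \sum_(v | v \notin comp_of G x) (#|comp_of G v| == s).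
Proof.
set a := #|_|.
have e t : vcount G t = (a == t) * a + \sum_(v | v \notin comp_of G x) (#|comp_of G
  v| == t).
  rewrite vcount_sum (bigID (mem (comp_of G x))) /=; congr (_ + _).
  transitivity (\sum_(v in comp_of G x) (a == t)).
    by apply: eq_bigr => v; rewrite inE => /comp_of_eq <-.
  by rewrite sum_nat_const mulnC.
rewrite /debit /upd; case: eqP => [->|ne]; first by rewrite e eqxx mul1n addKn.
by rewrite e (_ : a == s = false) //; apply/eqP => es; case: ne.
Qed.

Lemma vcount_comp_of_ge G x : #|comp_of G x| <= vcount G #|comp_of G x|.
Proof.
apply/subset_leq_card/subsetP=> v; move=> xv.
by rewrite !inE in xv *; rewrite (comp_of_eq xv).
Qed.

Lemma debit_comp_of_ge G x y : ~~ connect G x y ->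
  #|comp_of G y| <= debit (vcount G) #|comp_of G x| #|comp_of G y|.
Proof.
move=> nxy; rewrite debit_vcount (bigID (mem (comp_of G y))) /=.
apply: leq_trans (leq_addr _ _); rewrite -[leqLHS]sum1_card.
rewrite [leqRHS](eq_bigl (mem (comp_of G y))) => [|v /=].
  by apply: leq_sum => v /=; rewrite inE => /comp_of_eq <-; rewrite eqxx.
rewrite andbC; case h: (v \in comp_of G y) => //=.
by rewrite (disjointFl (disjoint_comp_of nxy) h).
Qed.

Lemma deficit_comp_of G x y : ~~ connect G x y ->
  deficit (vcount G) #|comp_of G x| #|comp_of G y| = 0.
Proof.
move=> nxy; have := vcount_comp_of_ge G x; have := debit_comp_of_ge nxy.
by rewrite /deficit; lia.
Qed.

Section Merge.
Variables (G : sgraph T) (x y : T).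
Hypotheses (clG : cluster_graph G) (nxy : ~~ connect G x y).
Let A := comp_of G x.
Let B := comp_of G y.
Let G1 := add_edges G (cross A B).
(** The intended connectivity of [G1], with [A] and [B] fused. Off the diagonal it is also the
    adjacency of [G1], which yields both that it equals [connect G1] and that [G1] is a cluster
    graph. *)
Let E1 : rel T := fun u v => if u \in A :|: B then v \in A :|: B else connect G u v.

Let AB_closed u v : connect G u v -> (u \in A :|: B) = (v \in A :|: B).
Proof.
move=> uv; rewrite !inE.
by rewrite !(connectC G _ u) !(connectC G _ v) !(same_connect (connectC G) uv).
Qed.

Let adjG1E u v : u != v -> G1 u v = E1 u v.
Proof.
move=> uv; rewrite /G1 /= /add_rel uv mem_cross /= /E1.
have uvE : G u v = connect G u v.
  by apply/idP/idP => [/connect1|/(elimT (clusterP G) clG)/(_ uv)].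
rewrite uvE !(in_setU).
have AA : (u \in A) && (v \in A) ==> connect G u v.
  by apply/implyP; rewrite !inE connectC => /andP[]; apply: connect_trans.
have BB : (u \in B) && (v \in B) ==> connect G u v.
  by apply/implyP; rewrite !inE connectC => /andP[]; apply: connect_trans.
have AB : connect G u v ==> ((u \in A) || (u \in B) == (v \in A) || (v \in B)).
  by apply/implyP => /AB_closed; rewrite !in_setU => ->.
move: AA BB AB; case: (connect G u v).
all: by case: (u \in A); case: (u \in B); case: (v \in A); case: (v \in B).
Qed.

Let connectG1E u v : connect G1 u v = E1 u v.
Proof.
apply/idP/idP.
  apply: connect_min => [w|w u' v'|u' v' h]; rewrite /E1.
  - by case: ifP => // h.
  - case: ifP => [wD -> //|wD]; case: ifP => [uD /=|uD]; last exact: connect_trans.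
    by move/AB_closed; rewrite uD wD.
  - by rewrite -/(E1 u' v') -adjG1E //; apply: contraL h => /eqP->; rewrite adj_irr.
case: (eqVneq u v) => [->|uv]; first by rewrite connect0.
by rewrite -adjG1E //; apply: connect1.
Qed.

Lemma cluster_merge : cluster_graph G1.
Proof. by apply/clusterP=> u v; rewrite connectG1E => h uv; rewrite adjG1E. Qed.

Lemma vcount_merge : vcount G1 =1 merge_count (vcount G) #|A| #|B|.
Proof.
move=> s; have dAB := disjoint_comp_of nxy.
have cD : #|A :|: B| = #|A| + #|B| by apply/eqP; rewrite (leq_card_setU A B).2.
(* The vertices outside [A :|: B] keep their components, so [r] is common to both graphs; what
   remains to compare are the contributions of [A], [B] and their union. *)
pose r t := \sum_(v | v \notin A :|: B) (#|comp_of G v| == t).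
have a0 : 0 < #|A| := comp_of_gt0 G x.
have b0 : 0 < #|B| := comp_of_gt0 G y.
have compG1 v : comp_of G1 v = if v \in A :|: B then A :|: B else comp_of G v.
  by apply/setP=> w; rewrite inE connectG1E /E1; case: ifP; rewrite ?inE.
have e1 t : vcount G1 t = r t + (#|A| + #|B| == t) * (#|A| + #|B|).
  rewrite vcount_sum (bigID (mem (A :|: B))) /= addnC; congr (_ + _).
    by apply: eq_bigr => v nv; rewrite compG1 (negbTE nv).
  rewrite -cD mulnC -sum_nat_const.
  by apply: eq_bigr => v hv; rewrite compG1 hv.
have e2 t : vcount G t = r t + (#|B| == t) * #|B| + (#|A| == t) * #|A|.
  rewrite vcount_sum (bigID (mem (A :|: B))) /= addnC -addnA; congr (_ + _).
  rewrite (eq_bigl (fun v => (v \in B) || (v \in A))) => [|v];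
    last by rewrite in_setU orbC.
  rewrite (bigID (mem A)) /= addnC; congr (_ + _); rewrite mulnC -sum_nat_const.
    apply: eq_big => v; last by case/andP=> /orP[|-> //]; rewrite inE => /comp_of_eq <-.
    by case h: (v \in A); rewrite /= ?andbT ?andbF ?orbF // (disjointFr dAB h).
  apply: eq_big => v; first by case h: (v \in A); rewrite /= ?andbT ?andbF ?orbT // .
  by case/andP=> _; rewrite inE => /comp_of_eq <-.
have d1 t : debit (vcount G) #|A| t = r t + (#|B| == t) * #|B|.
  rewrite /debit /upd !e2; case: (t =P #|A|) => [->|ne].
    by rewrite [#|A| == #|A|]eqxx mul1n addnK.
  by rewrite [#|A| == t]eq_sym (introF eqP ne) addn0.
have d2 t : debit (debit (vcount G) #|A|) #|B| t = r t.
  rewrite -[LHS]/(if t == #|B| then _ - #|B| else _) !d1; case: (t =P #|B|) => [->|ne].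
    by rewrite [#|B| == #|B|]eqxx mul1n addnK.
  by rewrite [#|B| == t]eq_sym (introF eqP ne) addn0.
rewrite e1 /merge_count /upd !d2; case: (s =P _) => [->|ne].
  by rewrite eqxx mul1n.
by rewrite eq_sym (introF eqP ne) addn0.
Qed.

End Merge.
End Cluster.

(** * Certificates *)

Record mstate := MState { cnt : nat -> nat; ma : nat; mb : nat; cost : nat; bad : nat }.

(* Every digit keeps [cost] equal to the cost of the merges done so far plus
   [ma * mb]. A merge without enough vertices is not undone but makes [bad]
   positive. *)
Definition digit_step (s : mstate) (d : nat) : mstate :=
  let: MState N a b c e := s in
  match d with
  | 0 => MState N a.+1 b (c + b) e
  | 1 => MState N a b.+1 (c + a) e
  | _ => MState (merge_count N a b) 0 0 c (e + deficit N a b)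
  end.

(** A word may call for a merge with size 0. Such a merge takes [b] vertices out and puts them back,
    matching the empty set of new edges. *)
Lemma merge_count0l N b s : b <= N b -> merge_count N 0 b s = N s.
Proof.
move=> h; rewrite /merge_count add0n /upd /debit /upd.
by repeat (case: eqP => //= ?; subst); lia.
Qed.

Lemma merge_count0r N a s : a <= N a -> merge_count N a 0 s = N s.
Proof.
move=> h; rewrite /merge_count addn0 /upd /debit /upd.
by repeat (case: eqP => //= ?; subst); lia.
Qed.

Lemma foldl_digit0 s n : foldl digit_step s (nseq n 0) =
  MState (cnt s) (ma s + n) (mb s) (cost s + n * mb s) (bad s).
Proof.
elim: n s => [|n IH] [N a b c e] /=; first by rewrite !addn0.
by rewrite IH /=; congr MState; lia.
Qed.

Lemma foldl_digit1 s n : foldl digit_step s (nseq n 1) =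
  MState (cnt s) (ma s) (mb s + n) (cost s + n * ma s) (bad s).
Proof.
elim: n s => [|n IH] [N a b c e] /=; first by rewrite !addn0.
by rewrite IH /=; congr MState; lia.
Qed.

(** * Soundness and completeness of words of merges *)

Section Reached.
Variables (T : finType) (G : sgraph T).
Implicit Types (F : {set {set T}}) (H : sgraph T).

Lemma add_edgesU H F F' :
  add_edges (add_edges H F) F' =2 add_edges H (F :|: F').
Proof.
by move=> u v /=; rewrite /add_rel /= /add_rel inE; case: (u != v);
  rewrite ?orbF //= orbA.
Qed.

Lemma add_edges0 H : add_edges H set0 =2 H.
Proof. by move=> u v /=; rewrite /add_rel inE andbF orbF. Qed.

(** Soundness invariant. The summand [ma s * mb s] is what has been charged in advance for the merge
    being spelled. Once [bad] is positive it stays so, and the counts need no longer belong to any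
    graph. *)
Definition reached (s : mstate) : Prop :=
  bad s = 0 -> exists F,
    [/\ F \subset non_edges G, cluster_graph (add_edges G F),
        #|F| + ma s * mb s <= cost s & cnt s =1 vcount (add_edges G F)].

Lemma vcount_gt0P H s : reflect (exists x, #|comp_of H x| = s) (0 < vcount H s).
Proof.
apply: (iffP card_gt0P) => [[x]|[x e]]; first by rewrite inE => /eqP; exists x.
by exists x; rewrite inE e.
Qed.

(** The first debit finds [x]. By [debit_vcount] the second one counts only vertices outside the
    component of [x], so [y] lies in another component even when [a = b]. *)
Lemma merge_comps H a b : 0 < a -> 0 < b -> deficit (vcount H) a b = 0 ->
  exists x y, [/\ ~~ connect H x y, #|comp_of H x| = a & #|comp_of H y| = b].
Proof.
move=> a0 b0 d0.
have /vcount_gt0P[x xa] : 0 < vcount H a by move: d0; rewrite /deficit; lia.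
have: 0 < debit (vcount H) a b by move: d0; rewrite /deficit; lia.
rewrite -xa debit_vcount lt0n sum_nat_eq0 => /forallPn[y].
rewrite negb_imply => /andP[nxy]; rewrite eqb0 negbK => /eqP yb.
by exists x, y; rewrite inE in nxy.
Qed.

Lemma reached_step s d : reached s -> reached (digit_step s d).
Proof.
case: s => N a b c e; rewrite /reached /= => h.
case: d => [|[|_]] /=.
- by move=> /h[F [h1 h2 h3 h4]]; exists F; split=> //; rewrite mulSn; lia.
- by move=> /h[F [h1 h2 h3 h4]]; exists F; split=> //; rewrite mulnS; lia.
move=> /eqP; rewrite addn_eq0 => /andP[/eqP e0 /eqP d0].
have [F [h1 h2 h3 h4]] := h e0.
case: (posnP a) => [a0|a0].
  exists F; split=> //; first by lia.
  move=> t; rewrite -h4 a0 merge_count0l //; move: d0; rewrite /deficit a0 /debit /upd.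
  by case: eqP => [->|]; lia.
case: (posnP b) => [b0|b0].
  exists F; split=> //; first by lia.
  by move=> t; rewrite -h4 b0 merge_count0r //; move: d0; rewrite /deficit; lia.
rewrite (deficit_ext _ _ h4) in d0.
have [x [y [nxy xa yb]]] := merge_comps a0 b0 d0.
set C := cross (comp_of (add_edges G F) x) (comp_of (add_edges G F) y).
have eE : add_edges (add_edges G F) C =2 add_edges G (F :|: C) := add_edgesU _ _ _.
exists (F :|: C); split.
- rewrite subUset h1 /=; apply/subsetP=> z /(subsetP (cross_sub_non_edges nxy)).
  case/non_edgesP=> u [v [-> uv nuv]]; rewrite mem_non_edges uv.
  by apply: contra nuv => guv; rewrite /= /add_rel guv.
- exact: eq_cluster_graph eE (cluster_merge x y h2).
- rewrite muln0 addn0; apply: leq_trans (leq_card_setU _ _) _.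
  by rewrite card_cross ?disjoint_comp_of // xa yb.
- move=> t; rewrite -(eq_vcount eE) (vcount_merge h2 nxy) xa yb.
  exact: merge_count_ext.
Qed.

Lemma reached_start : cluster_graph G -> reached (MState (vcount G) 0 0 0 0).
Proof.
move=> clG _; exists set0; rewrite sub0set cards0; split=> //.
  by apply: eq_cluster_graph clG => u v; rewrite add_edges0.
by move=> s; apply/eq_vcount => u v; rewrite add_edges0.
Qed.

End Reached.

Lemma completion_digits (T : finType) (G : sgraph T) (F : {set {set T}}) N c :
  cluster_graph G -> F \subset non_edges G -> cluster_graph (add_edges G F) ->
  N =1 vcount G ->
  exists ds N', [/\ size ds <= 3 * #|F|, all (fun d => d < 3) ds,
     foldl digit_step (MState N 0 0 c 0) ds = MState N' 0 0 (c + #|F|) 0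
     & N' =1 vcount (add_edges G F)].
Proof.
have [m] := ubnP #|F|; elim: m G F N c => // m IH G F N c;
  rewrite ltnS => lem clG sF clH eN.
have [->|[e eF]] := set_0Vmem F.
  exists [::], N; rewrite cards0 addn0; split=> // s.
  by rewrite eN; apply: eq_vcount => u v; rewrite add_edges0.
have /non_edgesP[x [y [ee xy nGxy]]] := subsetP sF _ eF.
have nxy : ~~ connect G x y by apply: contra nGxy => h; apply: (elimT (clusterP G) clG).
set A := comp_of G x; set B := comp_of G y; set C := cross A B.
have sCN : C \subset non_edges G := cross_sub_non_edges nxy.
have sub_conn u v : connect G u v -> connect (add_edges G F) u v.
  by apply: connect_sub => {}u {}v h; apply: connect1; rewrite /= /add_rel h.
(* In the completed graph [u] reaches [v] through the added edge [xy], so they are adjacent there;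
   as they are not adjacent in [G], the pair belongs to [F]. *)
have sCF : C \subset F.
  apply/subsetP=> z zC; have := subsetP sCN _ zC.
  case/imsetP: zC => [[u v] /setXP[/=]]; rewrite !inE => xu yv -> {z}.
  rewrite mem_non_edges => /andP[uv nuv].
  have : add_edges G F u v.
    apply: (elimT (clusterP _) clH) uv.
    apply: (@connect_trans _ _ x); first by rewrite connectC sub_conn.
    apply: (@connect_trans _ _ y); last exact: sub_conn.
    by apply: connect1; rewrite /= /add_rel xy -ee eF orbT.
  by rewrite /= /add_rel (negbTE nuv) uv.
have cC : #|C| = #|A| * #|B| by rewrite card_cross ?disjoint_comp_of.
have a0 : 0 < #|A| := comp_of_gt0 G x.
have b0 : 0 < #|B| := comp_of_gt0 G y.
have aab : #|A| <= #|A| * #|B| by rewrite leq_pmulr.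
have bab : #|B| <= #|A| * #|B| by rewrite leq_pmull.
have cF : #|F| = #|A| * #|B| + #|F :\: C| by rewrite -cC -(cardsID C F) (setIidPr sCF).
have eE : add_edges (add_edges G C) (F :\: C) =2 add_edges G F.
  by move=> u v; rewrite add_edgesU setDE setUIr setUCr setIT (setUidPr sCF).
have [|||||ds [N' [h1 h2 h3 h4]]] :=
  IH (add_edges G C) (F :\: C) (merge_count N #|A| #|B|) (c + #|A| * #|B|).
- by apply: leq_trans lem; rewrite cF -[leqLHS]add1n leq_add2r muln_gt0 a0.
- exact: cluster_merge.
- apply/subsetP=> z; rewrite inE => /andP[zC zF]; have := subsetP sF _ zF.
  case/non_edgesP=> u [v [ez uv nuv]]; rewrite ez mem_non_edges uv /= /add_rel.
  by rewrite (negbTE nuv) -ez (negbTE zC) andbF.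
- by apply: eq_cluster_graph clH => u v; rewrite eE.
- by move=> s; rewrite (vcount_merge clG nxy); apply: merge_count_ext.
exists (nseq #|A| 0 ++ nseq #|B| 1 ++ 2 :: ds), N'; split.
- by rewrite !size_cat !size_nseq /= cF; clear -h1 a0 aab bab; lia.
- by rewrite !all_cat !all_nseq /= h2 !orbT.
- rewrite !foldl_cat foldl_digit0 foldl_digit1 /= (deficit_ext _ _ eN)
  (deficit_comp_of nxy).
  by rewrite !addn0 !add0n muln0 addn0 (mulnC #|B|) h3 cF addnA.
- by move=> s; rewrite h4; apply: eq_vcount.
Qed.

(** Truncated subtraction is enough since [s] and [t] occur in both orders. The bound [n], which no
    component exceeds, makes the test a finite scan. *)
Definition balanced_count n eta (N : nat -> nat) : Prop :=
  forall s t, s <= n -> t <= n -> 0 < N s -> 0 < N t -> s - t <= eta.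

Lemma balancedP n (H : sgraph 'I_n) eta :
  reflect (balanced_count n eta (vcount H)) (balanced eta H).
Proof.
apply: (iffP forall_inP) => [h s t _ _ /vcount_gt0P[x <-] /vcount_gt0P[y <-]|h].
  have hx : comp_of H x \in components H by apply/imsetP; exists x.
  have hy : comp_of H y \in components H by apply/imsetP; exists y.
  by have /forall_inP/(_ _ hy) := h _ hx; lia.
move=> _ /imsetP[x _ ->]; apply/forall_inP=> _ /imsetP[y _ ->].
rewrite -/(comp_of H x) -/(comp_of H y).
have le z : #|comp_of H z| <= n by rewrite -[leqRHS]card_ord max_card.
have p z : 0 < vcount H #|comp_of H z| by apply/vcount_gt0P; exists z.
by have := h _ _ (le x) (le y) (p x) (p y);
  have := h _ _ (le y) (le x) (p y) (p x); lia.
Qed.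

(* Reads the next ternary digit of y / 3 ^ L off without any division. *)
Definition decode_step (P : nat) (sy : mstate * nat) : mstate * nat :=
  let: (s, y) := sy in
  let z := y + y + y in
  if z < P then (digit_step s 0, z)
  else if z - P < P then (digit_step s 1, z - P)
  else (digit_step s 2, z - P - P).

Definition decode P L s x : mstate := (iter L (decode_step P) (s, x)).1.

Definition accepts n k eta (s : mstate) : Prop :=
  [/\ cost s <= k, bad s = 0 & balanced_count n eta (cnt s)].

Lemma decode_ind P L s x (I : mstate -> Prop) :
  (forall s d, I s -> I (digit_step s d)) -> I s -> I (decode P L s x).
Proof.
move=> h; rewrite /decode; elim: L s x => // L IH s x i0; rewrite iterSr /decode_step.
by case: ifP => _; [|case: ifP => _]; apply: IH; apply: h.
Qed.

(** The witness is the word read as a ternary number, leading digit first. Since the machine triples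
    instead of dividing, after [M] digits it holds the unread number times [3 ^ M]; the induction is
    stated for such multiples. *)
Lemma decode_digits L s ds : all (fun d => d < 3) ds -> size ds = L ->
  exists2 x, x < 3 ^ L & decode (3 ^ L) L s x = foldl digit_step s ds.
Proof.
move=> ads <-; set P := 3 ^ size ds.
suff: forall M, P = 3 ^ (M + size ds) -> exists2 x, x * 3 ^ M < P &
  decode P (size ds) s (x * 3 ^ M) = foldl digit_step s ds.
  by case/(_ 0 erefl) => x; rewrite muln1; exists x.
have : 0 < P by rewrite expn_gt0.
move: P => P P0; elim: ds s ads => [|d ds IH] s /= => [_ M eP|/andP[d3 ads] M eP].
  by exists 0; rewrite ?mul0n.
have [|x xP ex] := IH (digit_step s d) ads M.+1; first by rewrite eP addnS.
have e3 : (d * 3 ^ size ds + x) * 3 ^ M * 3 = d * P + x * 3 ^ M.+1.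
  by rewrite eP !addnS !expnSr expnD; lia.
exists (d * 3 ^ size ds + x); first by nia.
rewrite -ex /decode iterSr; congr (iter _ _ _).1.
rewrite /decode_step (_ : _ + _ + _ = d * P + x * 3 ^ M.+1); last by rewrite -e3; lia.
move: (x * 3 ^ M.+1) xP => z zP {e3 ex IH}.
case: d d3 => [|[|[|//]]] _; rewrite ?mul0n ?mul1n ?add0n ?zP //.
  by rewrite ltnNge leq_addr /= addKn zP.
by rewrite mulSn mul1n -addnA ltnNge leq_addr /= addKn ltnNge leq_addr /= addKn.
Qed.

Lemma search_correct n (G : sgraph 'I_n) k eta N :
  cluster_graph G -> N =1 vcount G ->
  reflect (exists2 x, x < 3 ^ (3 * k).+1 &
    accepts n k eta (decode (3 ^ (3 * k).+1) (3 * k).+1 (MState N 0 0 0 0) x))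
  (balanced_cluster_completion G k eta).
Proof.
move=> clG eN; apply: (iffP existsP) => [[F /and4P[sF ck clH bH]]|[x _ [ck b0 bal]]].
  have [ds [N' [h1 h2 h3 h4]]] := completion_digits 0 clG sF clH eN.
  (* After the last merge [mb] is 0, so padding with the digit 0 raises [ma] but not [cost]. *)
  have [||x ltx ex] := @decode_digits (3 * k).+1 (MState N 0 0 0 0) (ds ++ nseq ((3
    * k).+1 - size ds) 0).
  - by rewrite all_cat h2 all_nseq orbT.
  - by rewrite size_cat size_nseq subnKC // ltnW // ltnS; apply: leq_trans h1 _;
    rewrite leq_mul2l.
  exists x => //; rewrite ex foldl_cat h3 foldl_digit0 /= muln0 addn0.
  split=> //=; have /balancedP bN := bH.
  by move=> s t; rewrite !h4; apply: bN.
have : reached G (decode (3 ^ (3 * k).+1) (3 * k).+1 (MState N 0 0 0 0) x).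
  apply: (@decode_ind _ _ _ _ (reached G)) => [s d|]; first exact: reached_step.
  move=> e0; have [F [h1 h2 h3 h4]] := reached_start clG e0.
  by exists F; split=> // s; rewrite -h4 /= eN.
case/(_ b0) => F [h1 h2 h3 h4]; exists F; rewrite h1 h2 /=.
(* A merge left unfinished by the word has been charged but adds no edge, so its term is dropped. *)
apply/andP; split; first exact: leq_trans (leq_addr _ _) (leq_trans h3 ck).
by apply/balancedP => s t; rewrite -!h4; apply: bal.
Qed.

(** * The program *)

(* Variables: 0 answer, 1 n, 2 k, 3 eta, 4 the constant 1, 5 the number of
   digits, 6 the number of certificates, 7 the certificate, 8 the part of it
   still to be decoded, 9-12 the fields [ma], [mb], [cost], [bad] of the
   state, 13-14 loop counters, 23 the constant 0; the others are temporary.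
   Array [true] holds the vertex counts of the input, [false] the current ones. *)
Definition read_row : cmd :=
  Seq (Block [:: PConst 16 1; PAdd 14 1 23])
 (Seq (Do (Block [:: PRead 15; PAdd 16 16 15; PSub 14 14 4]) 14)
      (Block [:: PLoad 15 true 16; PAdd 15 15 4; PStore true 16 15; PSub 13 13 4])).

(** Variable 15 becomes [1 - n], which is positive only for [n = 0], where the loop over the rows
    must be skipped. *)
Definition read_input : cmd :=
  Seq (Block [:: PConst 4 1; PRead 1; PRead 2; PRead 3; PAdd 13 1 23; PSub 15 4 1])
      (Unless 15 (Do read_row 13)).

Definition set_bounds : cmd :=
  Seq (Block [:: PAdd 5 2 2; PAdd 5 5 2; PAdd 5 5 4; PAdd 13 5 23; PConst 6 1])
      (Do (Block [:: PAdd 15 6 6; PAdd 6 6 15; PSub 13 13 4]) 13).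

Definition restore : cmd :=
  Seq (Block [:: PAdd 13 1 5; PAdd 13 13 4])
      (Do (Block [:: PSub 13 13 4; PLoad 15 true 13; PStore false 13 15]) 13).

(* Variables 17, 18, 19 vanish iff the digit is 0, 1, 2 respectively. *)
Definition split_digit : cmd :=
  Block [:: PAdd 15 8 8; PAdd 8 8 15; PAdd 17 8 4; PSub 17 17 6;
            PSub 22 8 6; PSub 18 6 8; PAdd 15 22 4; PSub 15 15 6;
            PAdd 18 18 15; PSub 19 6 22; PSub 13 13 4].

Definition debit_entry j : cmd :=
  Block [:: PLoad 15 false j; PSub 16 j 15; PAdd 12 12 16; PSub 15 15 j;
            PStore false j 15].

Definition merge_entries : cmd :=
  Seq (debit_entry 9) (Seq (debit_entry 10)
      (Block [:: PAdd 16 9 10; PLoad 15 false 16; PAdd 15 15 16;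
                 PStore false 16 15; PConst 9 0; PConst 10 0; PSub 8 22 6])).

(** The three flags are fixed before any branch runs and exactly one of them is 0, so exactly one
    branch is executed. *)
Definition next_digit : cmd :=
  Seq split_digit
 (Seq (Unless 17 (Block [:: PAdd 9 9 4; PAdd 11 11 10]))
 (Seq (Unless 18 (Block [:: PAdd 10 10 4; PAdd 11 11 9; PAdd 8 22 23]))
      (Unless 19 merge_entries))).

Definition run_digits : cmd :=
  Seq (Block [:: PAdd 8 7 23; PConst 9 0; PConst 10 0; PConst 11 0; PConst 12 0;
                 PAdd 13 5 23])
      (Do next_digit 13).

(** The scan descends from [n]: variable 20 keeps the first size met, the largest, and 21 is
    overwritten down to the smallest. Sizes met before entry [i] exceed [i], so the value 0 of
    variable 20 safely means that none has been met. *)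
Definition extremes : cmd :=
  Seq (Block [:: PConst 20 0; PConst 21 0; PAdd 13 1 4])
      (Do (Seq (Block [:: PSub 13 13 4; PLoad 15 false 13; PSub 15 4 15])
               (Unless 15 (Seq (Block [:: PAdd 21 13 23])
                               (Unless 20 (Block [:: PAdd 20 13 23]))))) 13).

(** Variable 15 adds up the excess of the spread over [eta], the excess of the cost over [k], and
    the shortage; it is 0 iff all three are. The answer is only ever set to 1, so a rejection cannot
    erase an earlier success. *)
Definition verdict : cmd :=
  Seq (Block [:: PSub 15 20 21; PSub 15 15 3; PSub 16 11 2; PAdd 15 15 16;
                 PAdd 15 15 12])
      (Unless 15 (Block [:: PConst 0 1])).

Definition try_certificate : cmd :=
  Seq (Block [:: PSub 7 7 4]) (Seq restore (Seq run_digits (Seq extremes verdict))).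

Definition solver : cmd :=
  Seq read_input
 (Seq set_bounds
 (Seq (Block [:: PAdd 7 6 23])
      (Do try_certificate 7))).

Arguments upd X i v j /.
Arguments upd_arr A t i v t' /.

(** * Correctness of the phases of one trial *)

Section Run.
Variables (n k eta L P : nat) (O : nat -> nat).

Definition env (x r : nat) (M : memory) : Prop :=
  [/\ var M 1 = n, var M 2 = k, var M 3 = eta, var M 4 = 1 & var M 5 = L] /\
  [/\ var M 6 = P, var M 7 = x, var M 0 = r, var M 23 = 0 & arr M true =1 O].

(** Copying the entries up to [n + L] is enough because both tables vanish beyond. *)
Lemma restore_runs x r M : (forall s, n < s -> O s = 0) -> env x r M ->
  (forall s, n + L < s -> arr M false s = 0) ->
  runs restore M (8 + (n + L).+1 * 13)
    (fun M' => env x r M' /\ arr M' false =1 O).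
Proof.
case: M => V A w O_big [[/= v1 v2 v3 v4 v5] [v6 v7 v0 v23 aT]] aF.
apply: runs_seq; apply: runs_block; rewrite /= v1 v5 v4 addn1.
pose Inv i M := [/\ env x r M, var M 13 = i &
  forall s, i <= s -> arr M false s = O s].
apply: (@runs_weaken _ _ _ _ (Inv 0)) => [|M' [h1 _ h2]|];
  [exact: leqnn | by split=> // s; apply: h2 |].
apply: runs_do => [|i [{V A v1 v2 v3 v4 v5 v6 v7 v0 v23 aT aF}V A {}w]].
  split=> //= s h; rewrite aF // O_big //; lia.
case=> [[[/= v1 v2 v3 v4 v5] [v6 v7 v0 v23 aT]] v13 aF].
apply: runs_block; split=> //=; last by rewrite v13 v4 subn1.
split=> //=; first by rewrite v13 v4 subn1.
move=> s h; rewrite v13 v4 subn1 /= aT; case: (s =P i) => [-> //|ne].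
by apply: aF; lia.
Qed.

Definition holds_state (s : mstate) (M : memory) : Prop :=
  [/\ var M 9 = ma s, var M 10 = mb s, var M 11 = cost s, var M 12 = bad s
    & arr M false =1 cnt s].

Lemma env_frame x r M M' :
  (forall v, v \in [:: 1; 2; 3; 4; 5; 6; 7; 0; 23] -> var M' v = var M v) ->
  arr M' true =1 arr M true -> env x r M -> env x r M'.
Proof.
move=> f eT [[v1 v2 v3 v4 v5] [v6 v7 v0 v23 aT]].
by split; split; rewrite ?f // => s; rewrite eT.
Qed.

Lemma split_digit_runs x r i s y M :
  env x r M -> holds_state s M -> var M 8 = y -> var M 13 = i.+1 ->
  let z := y + y + y in
  runs split_digit M 44 (fun M' =>
    [/\ env x r M', holds_state s M', var M' 13 = i & var M' 8 = z] /\
    [/\ var M' 22 = z - P, var M' 17 = z.+1 - P,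
        var M' 18 = (P - z) + ((z - P).+1 - P) & var M' 19 = P - (z - P)]).
Proof.
case: M => V A w [[/= v1 v2 v3 v4 v5] [v6 v7 v0 v23 aT]].
move=> [/= v9 v10 v11 v12 aF] v8 v13.
apply: runs_block; rewrite /= v4 v6 v8 v13 subn1 addnA /= !addn1.
by do !split.
Qed.

Lemma debit_entry_runs j M : (j == 9) || (j == 10) ->
  runs (debit_entry j) M 20 (fun M' =>
    [/\ (forall v, v \notin [:: 12; 15; 16] -> var M' v = var M v),
        var M' 12 = var M 12 + (var M j - arr M false (var M j)),
        arr M' true = arr M true
      & arr M' false = debit (arr M false) (var M j)]).
Proof.
case: M => V A w hj; apply: runs_block.
by case/orP: hj => /eqP-> /=; split=> // v;
  rewrite !inE !negb_or => /and3P[/negbTE-> /negbTE-> /negbTE->].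
Qed.

Lemma merge_entries_runs x r i N a b c e y M :
  env x r M -> holds_state (MState N a b c e) M -> var M 22 = y -> var M 13 = i ->
  runs merge_entries M (20 + (20 + 28)) (fun M' =>
    [/\ env x r M', holds_state (digit_step (MState N a b c e) 2) M',
        var M' 8 = y - P & var M' 13 = i]).
Proof.
move=> E [/= v9 v10 v11 v12 aF] v22 v13.
apply: runs_seq; apply: runs_weaken (leqnn _) _ (debit_entry_runs M (isT : (9 == 9)
  || _)).
move=> M1 [f1 g1 t1 u1].
apply: runs_seq; apply: runs_weaken (leqnn _) _ (debit_entry_runs M1 (isT : (10 ==
  9) || _)).
move=> M2 [f2 g2 t2 u2].
have f v : v \notin [:: 12; 15; 16] -> var M2 v = var M v by move=> h; rewrite f2 ?f1.
have {}E : env x r M2 by apply: env_frame E => [v|]; rewrite ?t2 ?t1 // !inE;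
  move=> h; apply: f; move: h; rewrite !inE; lia.
rewrite g1 (f1 10 isT) u1 in g2; rewrite (f1 10 isT) u1 in u2.
have w9 := f 9 isT; have w10 := f 10 isT; have w11 := f 11 isT.
have w22 := f 22 isT; have w13 := f 13 isT;
  move: {f f1 f2 g1 u1 t1 t2}w9 w10 w11 w22 w13.
rewrite v9 v10 v11 v22 v13 => w9 w10 w11 w22 w13; rewrite v9 v10 v12 in g2 u2.
case: M2 E g2 u2 w9 w10 w11 w22 w13 => V A w [[/= v1 v2 v3 v4 v5] [v6 v7 v0 v23 aT]].
move=> g2 u2 w9 w10 w11 w22 w13; apply: runs_block => /=.
split=> //; rewrite ?w22 ?v6 //; split=> //=.
  by rewrite g2 -addnA -(deficit_ext _ _ aF).
by move=> t; rewrite w9 w10 u2 -(merge_count_ext _ _ aF).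
Qed.

Lemma next_digit_runs x r i s y M :
  env x r M -> holds_state s M -> var M 8 = y -> var M 13 = i.+1 ->
  runs next_digit M (44 + (9 + (13 + 69))) (fun M' =>
    [/\ env x r M', holds_state (decode_step P (s, y)).1 M',
        var M' 8 = (decode_step P (s, y)).2 & var M' 13 = i]).
Proof.
move=> E S v8 v13; apply: runs_seq.
apply: runs_weaken (leqnn _) _ (split_digit_runs E S v8 v13) => {M E S v8 v13} M.
rewrite /decode_step; move: (y + y + y) => z [[E S v13 v8] [v22 v17 v18 v19]].
case: s S => N a b c e S.
case: ltnP => zP; [|case: ltnP => zP'].
- case: M E S v13 v8 v22 v17 v18 v19 => V A w [[/= v1 v2 v3 v4 v5] [v6 v7 v0 v23 aT]].
  move=> [/= v9 v10 v11 v12 aF] v13 v8 v22 v17 v18 v19.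
  apply: runs_seq; apply: runs_unless => /= [|_]; first by lia.
  apply: runs_block; apply: runs_seq; apply: runs_unless => /= [_|]; last by lia.
  apply: runs_unless => /= [_|]; last by lia.
  by do !split=> //=; rewrite ?v9 ?v11 ?v10 ?v4 ?addn1.
- case: M E S v13 v8 v22 v17 v18 v19 => V A w [[/= v1 v2 v3 v4 v5] [v6 v7 v0 v23 aT]].
  move=> [/= v9 v10 v11 v12 aF] v13 v8 v22 v17 v18 v19.
  apply: runs_seq; apply: runs_unless => /= [_|]; last by lia.
  apply: runs_seq; apply: runs_unless => /= [|_]; first by lia.
  apply: runs_block; apply: runs_unless => /= [_|]; last by lia.
  by do !split=> //=; rewrite ?v9 ?v11 ?v10 ?v4 ?v22 ?v23 ?addn1 ?addn0.
- apply: runs_seq; apply: runs_unless => /= [_|]; last by lia.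
  apply: runs_seq; apply: runs_unless => /= [_|]; last by lia.
  apply: runs_unless => /= [|_]; first by lia.
  exact: merge_entries_runs.
Qed.

Lemma run_digits_runs x r M : 0 < L -> env x r M -> arr M false =1 O ->
  runs run_digits M (24 + L * 136) (fun M' => env x r M' /\
    holds_state (decode P L (MState O 0 0 0 0) x) M').
Proof.
case: M => V A w L0 [[/= v1 v2 v3 v4 v5] [v6 v7 v0 v23 aT]] aF.
apply: runs_seq; apply: runs_block; rewrite /= v5 v7 v23 !addn0.
pose st j := iter j (decode_step P) (MState O 0 0 0 0, x).
pose Inv i M := exists2 j, j + i = L &
  [/\ env x r M, holds_state (st j).1 M, var M 8 = (st j).2 & var M 13 = i].
rewrite -[X in X * _](prednK L0);
  apply: (@runs_weaken _ _ _ _ (Inv 0)) => [|M' [j]|]; [exact: leqnn | |].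
  by rewrite addn0 => -> [h1 h2 _ _].
apply: runs_do => [|i M [j ej [E S v8 v13]]].
  by exists 0; rewrite ?prednK // /st.
apply: runs_weaken (leqnn _) _ (next_digit_runs E S v8 v13) => M' h.
split; last by case: h.
by exists j.+1; [lia | rewrite /st iterS -surjective_pairing in h *].
Qed.

(* [lo] and [hi] are 0 as long as no size has been met. *)
Definition extremes_of (C : nat -> nat) i lo hi : Prop :=
  (forall s, i <= s <= n -> 0 < C s -> lo <= s <= hi) /\
  ([/\ lo = 0, hi = 0 & forall s, i <= s <= n -> C s = 0] \/
   [/\ i <= lo, lo <= hi <= n, 0 < C lo & 0 < C hi]).

(** When some size occurs, [lo] and [hi] occur themselves and enclose all others, so their
    difference is the largest one; when none occurs, both sides hold. *)
Lemma balanced_extremes C lo hi :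
  extremes_of C 0 lo hi -> (hi - lo <= eta <-> balanced_count n eta C).
Proof.
case=> h [[-> -> z]|[_ /andP[lh hn] Cl Ch]].
  by split=> // _ s t sn tn; rewrite z //= sn.
split=> [le s t sn tn Cs Ct|b]; last by apply: b => //; apply: leq_trans hn.
have := h s; have := h t; rewrite sn tn => /(_ isT Ct) ? /(_ isT Cs) ?; lia.
Qed.

Lemma extremes_runs x r s M : env x r M -> holds_state s M ->
  runs extremes M (12 + n.+1 * 23) (fun M' => [/\ env x r M', holds_state s M' &
    extremes_of (cnt s) 0 (var M' 21) (var M' 20)]).
Proof.
case: M => V A w [[/= v1 v2 v3 v4 v5] [v6 v7 v0 v23 aT]] [/= v9 v10 v11 v12 aF].
apply: runs_seq; apply: runs_block; rewrite /= v1 v4 addn1.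
pose Inv i M := [/\ env x r M, holds_state s M, var M 13 = i, i <= n.+1 &
    extremes_of (cnt s) i (var M 21) (var M 20)].
apply: (@runs_weaken _ _ _ _ (Inv 0)) => [|M' [h1 h2 _ _ h3] //|]; first exact: leqnn.
apply: runs_do => [|i].
  split=> //=; split=> [t|]; first by lia.
  by left; split=> // t; lia.
case=> {V A w v1 v2 v3 v4 v5 v6 v7 v0 v23 aT v9 v10 v11 v12 aF} V A w.
case=> [[[/= v1 v2 v3 v4 v5] [v6 v7 v0 v23 aT]] [/= v9 v10 v11 v12 aF] v13 ltin [J1
  J2]].
apply: (@runs_weaken _ _ (12 + (4 + 5).+1) _ _ _ (leqnn _) (fun _ h => h)).
apply: runs_seq; apply: runs_block; rewrite /= v13 v4 subn1 /= aF.
apply: runs_unless => /= [C0|C1].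
  have Ci : cnt s i = 0 by lia.
  split=> //; split=> //=; [exact: ltnW | split=> [t ht Ct|]].
    by apply: J1 => //; case: (t =P i) => [e|]; [move: Ct; rewrite e Ci | lia].
  case: J2 => [[-> -> z]|[h1 h2 h3 h4]]; [left|right]; split=> //; last by lia.
  by move=> t ht; case: (t =P i) => [->//|ne]; apply: z; lia.
apply: runs_seq; apply: runs_block => /=; rewrite v23 addn0.
apply: runs_unless => /= [hi0|hi0].
  split=> //; split=> //=; first exact: ltnW.
  case: J2 => [[l0 h0 z]|[h1 h2 h3 h4]]; first by lia.
  split; last by right; split=> //; lia.
  move=> t ht Ct; case: (t =P i) => [e|ne]; first by lia.
  by have := J1 t; rewrite Ct => /(_ _ isT); lia.
apply: runs_block => /=; rewrite v23 addn0.
split=> //; split=> //=; first exact: ltnW.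
case: J2 => [[l0 h0 z]|[h1 h2 h3 h4]]; last by lia.
split; last by right; split=> //; lia.
move=> t ht Ct; case: (t =P i) => [->|ne]; first by rewrite leqnn.
by move: Ct; rewrite z //; lia.
Qed.

Lemma verdict_runs x (r : bool) s M : env x r M -> holds_state s M ->
  extremes_of (cnt s) 0 (var M 21) (var M 20) ->
  runs verdict M (20 + 5) (fun M' => exists r' : bool,
    [/\ env x r' M', arr M' false =1 cnt s & r' <-> r \/ accepts n k eta s]).
Proof.
case: M => V A w [[/= v1 v2 v3 v4 v5] [v6 v7 v0 v23 aT]] [/= v9 v10 v11 v12 aF].
move=> /balanced_extremes bal; apply: runs_seq; apply: runs_block => /=.
rewrite v11 v12 v3 v2; apply: runs_unless => /= h.
  exists r; split=> //; split; [by left | case=> // -[c1 b0 /bal]; lia].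
apply: runs_block; exists true; split=> //; split=> // _; right.
by split; [lia | lia | apply/bal; lia].
Qed.
End Run.

(* A failed merge may still write beyond entry n, which [restore] must undo;
   but it never writes beyond the number of digits. *)
Lemma decode_big m P L N x t : L <= m -> (forall t, m < t -> N t = 0) ->
  m < t -> cnt (decode P L (MState N 0 0 0 0) x) t = 0.
Proof.
(* Each digit raises [ma + mb] by at most one, so after [j] digits a merge writes at entry [j] or
   below. *)
move=> Lm N0; pose ok j s := ma s + mb s <= j /\ forall t, m < t -> cnt s t = 0.
have step j s d : j < m -> ok j s -> ok j.+1 (digit_step s d).
  case: s => N' a b c e jm [/= ab N'0]; case: d => [|[|d]]; split=> //=; try by lia.
  move=> u mu; rewrite /merge_count /debit /=; have := N'0 u mu.
  by repeat case: eqP => //= ?; subst; lia.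
suff: ok L (decode P L (MState N 0 0 0 0) x) by case=> _; apply.
rewrite /decode; elim: L Lm => [|L IH] Lm /=; first by split.
move: (IH (ltnW Lm)); case: (iter L _ _) => s y /= okL.
by case: ifP => _; [|case: ifP => _]; apply: step.
Qed.

(** * The loop over all certificates *)

Section SearchLoop.
Variables (n k eta L P : nat) (O : nat -> nat).
Hypothesis (L_gt0 : 0 < L) (P_gt0 : 0 < P).
Hypothesis O_big : forall s, n < s -> O s = 0.

Definition accepting x : Prop :=
  accepts n k eta (decode P L (MState O 0 0 0 0) x).

(** Certificates are tried downwards from [P - 1]. The clause on the entries beyond [n + L] is what
    the next [restore] relies on. *)
Definition searched i (M : memory) : Prop := exists r : bool,
  [/\ env n k eta L P O i r M, (forall s, n + L < s -> arr M false s = 0)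
    & r <-> exists2 x, i <= x < P & accepting x].

Definition try_time : nat :=
  4 + ((8 + (n + L).+1 * 13) + ((24 + L * 136) + ((12 + n.+1 * 23) + (20 + 5)))).

Lemma try_certificate_runs i M : i < P -> searched i.+1 M ->
  runs try_certificate M try_time (fun M' => searched i M' /\ var M' 7 = i).
Proof.
case: M => V A w iP [r [[[/= v1 v2 v3 v4 v5] [v6 v7 v0 v23 aT]] /= aF hr]].
apply: runs_seq; apply: runs_block; rewrite /= v7 v4 subn1 /=; set M := Mem _ _ _.
have E : env n k eta L P O i r M by [].
apply: runs_seq; apply: runs_weaken (leqnn _) _ (restore_runs O_big E aF) =>
  {V A w v1 v2 v3 v4 v5 v6 v7 v0 v23 aT aF M E} M [E aF].
apply: runs_seq; apply: runs_weaken (leqnn _) _ (run_digits_runs L_gt0 E aF) =>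
  {M E aF} M [E S].
apply: runs_seq; apply: runs_weaken (leqnn _) _ (extremes_runs E S) =>
  {M E S} M [E S X].
apply: runs_weaken (leqnn _) _ (verdict_runs E S X) => {M E S X} M [r' [E aF hr']].
split; last by case: E => _ [].
exists r'; split=> // [s hs|].
  rewrite aF; apply: (@decode_big (n + L)) => // [|t ht]; first exact: leq_addl.
  by apply: O_big; apply: leq_ltn_trans (leq_addr _ _) ht.
split=> [/hr'[/hr[x hx ax]|acc]|[x hx ax]].
- by exists x => //; lia.
- by exists i => //; rewrite leqnn.
- apply/hr'; case: (x =P i) => [<-|ne]; [by right | left; apply/hr].
  by exists x => //; lia.
Qed.

Lemma search_runs M : env n k eta L P O P 0 M ->
  (forall s, n + L < s -> arr M false s = 0) ->
  runs (Do try_certificate 7) M (P * try_time.+1) (searched 0).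
Proof.
move=> E aF; rewrite -[X in X * _.+1](prednK P_gt0).
pose Inv i M := i <= P /\ searched i M.
apply: (@runs_weaken _ _ _ _ (Inv 0)) => [|M' [] //|]; first exact: leqnn.
apply: runs_do => [|i {E aF}M [iP S]].
  rewrite prednK //; split=> //; exists false; split=> //.
  by split=> // -[x]; lia.
apply: runs_weaken (leqnn _) _ (try_certificate_runs iP S) => M' [S' v7].
by split=> //; split=> //; apply: ltnW.
Qed.
End SearchLoop.

(** In a cluster graph the component of [v] is its closed neighbourhood, so a single matrix row
    yields its size and the machine never explores the graph. *)
Lemma card_comp_of (T : finType) (G : sgraph T) v : cluster_graph G ->
  #|comp_of G v| = (count (G v) (enum T)).+1.
Proof.
move=> /clusterP clG; rewrite (cardD1 v) inE connect0 add1n; congr _.+1.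
rewrite -size_filter enumT -cardE; apply: eq_card => w; rewrite !inE.
apply/andP/idP => [[wv /clG]|h]; first by rewrite eq_sym; apply.
have {}h : G v w by [].
by rewrite connect1 //; split=> //; apply: contraL h => /eqP->; rewrite adj_irr.
Qed.

Lemma vcount_count n (G : sgraph 'I_n) s : cluster_graph G ->
  vcount G s = count (fun v => (count (G v) (enum 'I_n)).+1 == s) (enum 'I_n).
Proof.
move=> clG; rewrite /vcount cardE enumT /enum_mem size_filter -enumT.
by apply: eq_count => v; rewrite /= inE card_comp_of.
Qed.

Definition read_time n : nat := 24 + (n * (8 + (n * 13 + 16)).+1).+1.

Section ReadInput.
Variables (n k eta : nat) (G : sgraph 'I_n).
Let row v := [seq nat_of_bool (G v j) | j <- enum 'I_n].
Let size_of v := (count (G v) (enum 'I_n)).+1.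

Definition loaded (M : memory) : Prop :=
  [/\ var M 1 = n, var M 2 = k, var M 3 = eta, var M 4 = 1 & var M 0 = 0] /\
  [/\ var M 23 = 0 & forall s, arr M false s = 0].

Lemma read_row_runs i v w M : 0 < n -> loaded M -> tape M = row v ++ w ->
  var M 13 = i.+1 ->
  runs read_row M (8 + (n * 13 + 16)) (fun M' => [/\ loaded M', tape M' = w,
    var M' 13 = i &
    forall s, arr M' true s = arr M true s + (size_of v == s)]).
Proof.
case: M => V A w0 n0 [[/= v1 v2 v3 v4 v0] [v23 aF]] -> {w0} v13.
apply: runs_seq; apply: runs_block; rewrite /= v1 v23 addn0.
(* [js] lists the unread columns. Variable 16 starts at 1 to count [v] itself, whose diagonal entry
   is 0. *)
pose Inv m M := exists js : seq 'I_n,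
  [/\ loaded M, size js = m, tape M = [seq nat_of_bool (G v j) | j <- js] ++ w &
    var M 14 = m] /\
  [/\ var M 16 + count (G v) js = size_of v, var M 13 = i.+1 & arr M true = A true].
apply: runs_seq.
apply: (@runs_weaken _ _ (n * 13) _ (Inv 0)); first exact: leqnn.
  case=> {V v1 v2 v3 v4 v0 v23 v13} V A' w' [js].
  case=> [[[[/= v1 v2 v3 v4 v0] [v23 aF']] /size0nil-> -> _] [/= v16 v13 aT]].
  rewrite addn0 in v16.
  apply: runs_block => /=; rewrite v13 v4 subn1 v16.
  split=> // s; rewrite aT eq_sym; case: eqP => [->|_]; rewrite ?addn1 ?addn0 //.
rewrite -[in n * 13](prednK n0).
apply: runs_do.
  exists (enum 'I_n); rewrite prednK // size_enum_ord; split; split=> //=.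
move=> m [{V v1 v2 v3 v4 v0 v23 v13 aF}V A' w'].
case=> [[|j js]] [[[[/= v1 v2 v3 v4 v0] [v23 aF]]] //= [sz] -> v14 [v16 v13 aT]].
apply: runs_block => /=; rewrite v14 v4 subn1; split=> //.
by exists js; split; split=> //=; rewrite -addnA.
Qed.

Lemma read_input_runs : cluster_graph G ->
  runs read_input (zero_mem (encode G k eta)) (read_time n)
    (fun M => loaded M /\ arr M true =1 vcount G).
Proof.
move=> clG; apply: runs_seq; apply: runs_block; rewrite /= addn0.
apply: runs_unless => /= [n0|n1].
  have {}n0 : n = 0 by lia.
  split=> // s /=; apply/esym/eqP; rewrite -leqn0 -[leqRHS]n0 -[leqRHS](card_ord n).
  exact: max_card.
have n0 : 0 < n by lia.
pose Inv m M := exists vs : seq 'I_n,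
  [/\ loaded M, size vs = m, tape M = flatten [seq row v | v <- vs] & var M 13 = m] /\
  forall s, arr M true s + count (fun v => size_of v == s) vs = vcount G s.
apply: (@runs_weaken _ _ (n * (8 + (n * 13 + 16)).+1) _ (Inv 0)); first exact: leqnn.
  by move=> M' [vs [[h /size0nil-> _ _] e]]; split=> // s; rewrite -e addn0.
rewrite -[X in X * _.+1](prednK n0).
apply: runs_do => [|m M].
  exists (enum 'I_n); rewrite prednK // size_enum_ord; split=> [|s]; first by split.
  by rewrite add0n vcount_count.
case=> [[|v vs]] [[Lo] //= [sz] tp v13 e].
apply: runs_weaken (leqnn _) _ (read_row_runs n0 Lo tp v13) => M' [Lo' tp' v13' e'].
split=> //; exists vs; split=> // s.
by rewrite e' -e -addnA.
Qed.
End ReadInput.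

Lemma set_bounds_runs n k eta L M O : L = (3 * k).+1 ->
  loaded n k eta M -> arr M true =1 O ->
  runs set_bounds M (20 + L * 13)
    (fun M' => env n k eta L (3 ^ L) O (var M' 7) 0 M' /\ forall s, arr M' false s = 0).
Proof.
case: M => V A w eL [[/= v1 v2 v3 v4 v0] [v23 aF]] aT.
apply: runs_seq; apply: runs_block; rewrite /= v2 v4 v23 addn0.
have -> : k + k + k + 1 = L by lia.
pose Inv i M := [/\ loaded n k eta M, arr M true =1 O, var M 5 = L, var M 13 = i
  & exists2 j, j + i = L & var M 6 = 3 ^ j].
apply: (@runs_weaken _ _ _ _ (Inv 0)); first exact: leqnn.
  move=> M' [[[w1 w2 w3 w4 w0] [w23 wF]] wT w5 _ [j]].
  by rewrite addn0 => -> w6; do !split.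
have L0 : 0 < L by rewrite eL.
rewrite -[X in X * 13](prednK L0); apply: runs_do => [|i].
  by rewrite prednK //; split=> //; exists 0.
case=> {V A w v1 v2 v3 v4 v0 v23 aF aT} V A w.
case=> [[[/= v1 v2 v3 v4 v0] [v23 aF]] aT v5 v13 [j ej v6]].
apply: runs_block => /=; rewrite v13 v4 subn1; split=> //; split=> //.
by exists j.+1; [lia | rewrite /= v6 expnS; lia].
Qed.

Definition solver_time n k : nat :=
  let L := (3 * k).+1 in
  read_time n + ((20 + L * 13) + (4 + 3 ^ L * (try_time n L).+1)).

Lemma solver_runs n (G : sgraph 'I_n) k eta : cluster_graph G ->
  runs solver (zero_mem (encode G k eta)) (solver_time n k)
    (fun M => var M 0 = balanced_cluster_completion G k eta :> nat).
Proof.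
move=> clG; apply: runs_seq.
apply: runs_weaken (leqnn _) _ (read_input_runs k eta clG) => M [Lo aT].
apply: runs_seq; apply: runs_weaken (leqnn _) _ (set_bounds_runs erefl Lo aT) =>
  {Lo aT}.
set L := (3 * k).+1; case=> V A w [[[/= v1 v2 v3 v4 v5] [v6 _ v0 v23 aT]] aF].
apply: runs_seq; apply: runs_block; rewrite /= v6 v23 addn0.
have big s : n < s -> vcount G s = 0.
  move=> ns; apply/eqP; rewrite -leqn0 leqNgt; apply/negP => /vcount_gt0P[x e].
  by have := max_card (mem (comp_of G x)); rewrite e card_ord leqNgt ns.
have P0 : 0 < 3 ^ L by rewrite expn_gt0.
set M' := Mem _ _ _.
have E : env n k eta L (3 ^ L) (vcount G) (3 ^ L) 0 M' by [].
apply: runs_weaken (leqnn _) _ (search_runs (ltn0Sn _ : 0 < L) P0 big E (fun s _ =>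
  aF s)).
move=> M1 [r [[_ [_ _ -> _ _]] _ hr]]; congr nat_of_bool.
apply/idP/(search_correct k eta clG (frefl _)) => [/hr[x /andP[_ h1] h2]|[x h1 h2]].
  by exists x.
by apply/hr; exists x.
Qed.

(** There are [3 * 27 ^ k] certificates, at most [3 * 2 ^ (6 * k)]. One more factor [2 ^ k] absorbs
    the terms linear in [k], and reading the matrix accounts for the square of [n]. The numerical
    constants are crude. *)
Lemma solver_time_leq n k :
  solver_time n k <= 3000 * 2 ^ (7 * k) * n.+1 ^ 2.
Proof.
have kK : k <= 2 ^ k by rewrite ltnW // ltn_expl.
have K1 : 0 < 2 ^ k by rewrite expn_gt0.
have PQ : 3 ^ (3 * k).+1 <= 3 * 2 ^ (6 * k).
  rewrite expnS leq_mul2l /= (expnM 3) (expnM 2).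
  by case: k {kK K1} => // k; rewrite leq_exp2r.
have Q1 : 0 < 2 ^ (6 * k) by rewrite expn_gt0.
have -> : 2 ^ (7 * k) = 2 ^ (6 * k) * 2 ^ k by rewrite -expnD; congr (2 ^ _); lia.
rewrite /solver_time /read_time /try_time.
move: (2 ^ (6 * k)) (3 ^ _) (2 ^ k) Q1 PQ kK K1 => Q P K Q1 PQ kK K1.
have KN : K <= K * n.+1 by rewrite leq_pmulr.
have NK : n.+1 <= K * n.+1 by rewrite leq_pmull.
set W := (4 + _).+1.
have lW : W <= 805 * (K * n.+1) by rewrite /W; lia.
have lPW : P * W <= 2415 * (Q * (K * n.+1)).
  by apply: leq_trans (leq_mul PQ lW) _; rewrite -mulnA (mulnCA Q) mulnA.
have KNQ : K * n.+1 <= Q * (K * n.+1) by rewrite leq_pmull.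
have NNQ : Q * (K * n.+1) <= Q * (K * n.+1) * n.+1 by rewrite leq_pmulr.
have NN : n.+1 * n.+1 <= Q * (K * n.+1) * n.+1 by rewrite leq_mul2r (leq_trans NK).
rewrite -[leqRHS]mulnA (_ : Q * K * n.+1 ^ 2 = Q * (K * n.+1) * n.+1); last by lia.
move: (Q * (K * n.+1) * n.+1) (Q * (K * n.+1)) lPW KNQ NNQ NN => Z Y lPW KNQ NNQ NN.
lia.
Qed.

Theorem mainTheorem4 :
  exists (P : program) (c : nat),
    forall (n : nat) (G : sgraph 'I_n) (k eta : nat),
      cluster_graph G ->
      answers_within P (encode G k eta) (c * 2 ^ (c * k) * n.+1 ^ c)
        (balanced_cluster_completion G k eta).
Proof.
(* A single constant serves as factor and in both exponents, where 7 and 2 would do. *)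
exists (code 0 solver), 3000 => n G k eta clG.
have wfs : wf solver by [].
apply: answers_within_leq (runs_answers wfs (solver_runs k eta clG)).
apply: leq_trans (solver_time_leq n k) _; rewrite -!mulnA leq_mul2l leq_mul //.
- by rewrite leq_exp2l // leq_mul2r orbT.
- exact: leq_pexp2l.
Qed.
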